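(* Let $n$ be a positive integer, let $A : \mathbb{R}^n \to \mathcal{S}^3$ be a linear map and let $B \in \mathcal{S}^3$. If the spectrahedron $\operatorname{SP}_{A,B} = \{x \in \mathbb{R}^n : A(x) + B \in \mathcal{S}_+^3\}$ has dimension at most $3$, then $\operatorname{SP}_{A,B}$ is affinely socr.
   Context: $\mathcal{S}^k$ denotes the vector space of real symmetric $k \times k$ matrices and $\mathcal{S}_+^k \subseteq \mathcal{S}^k$ the cone of symmetric positive semidefinite matrices. For a linear map $A : \mathbb{R}^n \to \mathcal{S}^k$ and $B \in \mathcal{S}^k$, the constraint $A(x) + B \in \mathcal{S}_+^k$ is called a linear matrix inequality (LMI) of size $k$, and the set $\operatorname{SP}_{A,B} := \{x \in \mathbb{R}^n : A(x) + B \in \mathcal{S}_+^k\}$ is the spectrahedron defined by it. The dimension of a convex set is the dimension of its affine hull. Let $\mathcal{Q} := \{x \in \mathbb{R}^3 : x_3 \ge \sqrt{x_1^2 + x_2^2}\}$ be the three-dimensional Lorentz cone and $\mathcal{Q}^m := \mathcal{Q} \times \cdots \times \mathcal{Q}$ ($m$ factors), a convex cone in $(\mathbb{R}^3)^m$. An affine slice of a convex cone $C \subseteq V$ in a real vector space $V$ is the intersection of $C$ with an affine subspace of $V$. A set is affinely socr (affinely second-order cone representable) if, for some positive integer $m$, it is the image of an affine slice of $\mathcal{Q}^m$ under an affine map. *)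

(* Defs.v *)
From HB Require Import structures.
From mathcomp Require Import all_boot all_order all_algebra.
From mathcomp Require Import all_classical all_reals.

Set Implicit Arguments.
Unset Strict Implicit.
Unset Printing Implicit Defensive.

Import Order.TTheory GRing.Theory Num.Theory.

Local Open Scope classical_set_scope.
Local Open Scope ring_scope.

Section AffineGeometry.
Variables (R : realType) (V : vectType R).
Implicit Types (S L C : set V) (p : V) (U : {vspace V}).

Definition flat p U : set V := [set x | x - p \in U].

(* Affine subspaces are nonempty here. *)
Definition affine_subspace L : Prop := exists p U, L = flat p U.

Definition affine_hull S : set V :=
  [set y | exists (k : nat) (x : 'I_k -> V) (w : 'I_k -> R),
     [/\ forall i, S (x i), \sum_i w i = 1 & y = \sum_i w i *: x i]].

(* [affine_dim S d] reads "the affine hull of S has dimension d"; the empty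
   set has dimension -1. *)
Definition affine_dim S (d : int) : Prop :=
  (S = set0 /\ d = -1) \/
  exists p U, affine_hull S = flat p U /\ d = (\dim U)%:Z.

Definition affine_slice C S : Prop :=
  exists2 L, affine_subspace L & S = C `&` L.

Definition affine_map (W : vectType R) (f : V -> W) : Prop :=
  exists (F : {linear V -> W}) (c : W), forall x, f x = F x + c.

Lemma affine_hull_comb2 S (a b : R) (p x y : V) :
  affine_hull S p -> affine_hull S x -> affine_hull S y ->
  affine_hull S (p + a *: (x - p) + b *: (y - p)).
Proof.
move=> [k0 [x0 [w0 [S0 e0 ->]]]] [k1 [x1 [w1 [S1 e1 ->]]]].
move=> [k2 [x2 [w2 [S2 e2 ->]]]].
pose glue T (f0 : 'I_k0 -> T) (f1 : 'I_k1 -> T) (f2 : 'I_k2 -> T)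
    (i : 'I_(k0 + (k1 + k2))) :=
  match fintype.split i with
  | inl j => f0 j
  | inr j => match fintype.split j with inl l => f1 l | inr l => f2 l end
  end.
exists (k0 + (k1 + k2))%N, (glue V x0 x1 x2).
exists (glue R (fun i => (1 - a - b) * w0 i) (fun i => a * w1 i)
  (fun i => b * w2 i)).
have sp m n (i : 'I_m) : fintype.split (lshift n i) = inl i.
  exact: (unsplitK (inl i)).
have sq m n (i : 'I_n) : fintype.split (rshift m i) = inr i.
  exact: (unsplitK (inr i)).
split.
- by move=> i; rewrite /glue; case: fintype.split => // j; case: fintype.split.
- rewrite !big_split_ord /=.
  under eq_bigr do rewrite /glue sp.
  under [X in _ + (X + _)]eq_bigr do rewrite /glue sq sp.
  under [X in _ + (_ + X)]eq_bigr do rewrite /glue sq sq.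
  by rewrite -!mulr_sumr e0 e1 e2 !mulr1 -[1 - a - b]addrA -opprD subrK.
- rewrite !big_split_ord /=.
  under [X in _ = X + _]eq_bigr do rewrite /glue sp -scalerA.
  under [X in _ = _ + (X + _)]eq_bigr do rewrite /glue sq sp -scalerA.
  under [X in _ = _ + (_ + X)]eq_bigr do rewrite /glue sq sq -scalerA.
  rewrite -!scaler_sumr !scalerBr -[1 - a - b]addrA -opprD scalerBl scale1r.
  by rewrite -addrA [X in _ + X]addrACA -opprD -scalerDl addrA addrAC.
Qed.

Lemma affine_dim_total S : exists d, affine_dim S d.
Proof.
have [->|/set0P[p Sp]] := eqVneq S set0; first by exists (-1); left.
have hp : affine_hull S p.
  exists 1%N, (fun=> p), (fun=> 1).
  by split=> //; rewrite big_ord1 // scale1r.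
pose P d := `[< exists U : {vspace V}, \dim U = d /\ flat p U `<=` affine_hull S >].
have P0 : exists d, P d.
  exists 0%N; apply/asboolP; exists 0%VS; split; first exact: dimv0.
  by move=> x; rewrite /flat /= memv0 subr_eq0 => /eqP ->.
have Pb d : P d -> (d <= \dim (fullv : {vspace V}))%N.
  by move=> /asboolP[U [<- _]]; exact: dimvS (subvf U).
have [d /asboolP[U [dU UH]] dmax] := ex_maxnP P0 Pb.
exists d%:Z; right; exists p, U; split; last by rewrite dU.
apply/seteqP; split=> // x hx; rewrite /flat /=.
apply: contrapT => /negP xU.
have UV : flat p (U + <[x - p]>)%VS `<=` affine_hull S.
  move=> y /memv_addP[u uU [v /vlineP[c ->] e]].
  have hu : affine_hull S (p + u) by apply: UH; rewrite /flat /= addrC addKr.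
  have := affine_hull_comb2 1 c hp hu hx.
  by rewrite scale1r [p + u]addrC addrK -addrA -e addrC subrK.
have := dmax _ (introT (asboolP _) (ex_intro _ _ (conj erefl UV))).
apply/negP; rewrite -ltnNge -dU ltnNge; apply/negP => le.
have /eqP eU : U == (U + <[x - p]>)%VS by rewrite eqEdim addvSl.
by move: xU; rewrite eU memvE addvSr.
Qed.

Lemma affine_dim_uniq S d e : affine_dim S d -> affine_dim S e -> d = e.
Proof.
have ne p U : affine_hull set0 = flat p U -> False.
  move=> E; have : flat p U p by rewrite /flat /= subrr mem0v.
  rewrite -E => -[[|k] [x [w [Sx s _]]]]; last exact: Sx ord0.
  by move: s; rewrite big_ord0 => /esym/eqP; rewrite oner_eq0.
move=> [[S0 ->]|[p [U [E ->]]]] [[S0' ->]|[q [W [E' ->]]]] //.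
- by move: E'; rewrite S0 => /ne.
- by move: E; rewrite S0' => /ne.
have fE x : (x - p \in U) = (x - q \in W).
  by apply/idP/idP => h; [have : flat q W x by rewrite -E' E
                        | have : flat p U x by rewrite -E E'].
have pq : p - q \in W by rewrite -fE subrr mem0v.
suff -> : U = W by [].
apply/vspaceP => v; rewrite -[v in LHS](addrK p) fE -addrA rpredDr //.
Qed.

End AffineGeometry.

Section Spectrahedra.
Variables (R : realType) (k : nat).

Definition psdmx (M : 'M[R]_k) : Prop :=
  M \is symmetricmx /\ forall v : 'cV[R]_k, 0 <= (v^T *m M *m v) 0 0.

Definition spectrahedron (n : nat) (A : 'rV[R]_n -> 'M[R]_k) (B : 'M[R]_k) :
    set 'rV[R]_n :=
  [set x | psdmx (A x + B)].

End Spectrahedra.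

Section SecondOrderCones.
Variable R : realType.

Definition lorentz_cone : set 'rV[R]_3 :=
  [set x | Num.sqrt (x 0 0 ^+ 2 + x 0 1 ^+ 2) <= x 0 2].

(* A point of (R^3)^m is the m x 3 matrix whose i-th row is its i-th
   component. *)
Definition lorentz_cone_pow (m : nat) : set 'M[R]_(m, 3) :=
  [set X | forall i, lorentz_cone (row i X)].

Definition affinely_socr (W : vectType R) (S : set W) : Prop :=
  exists m : nat, (0 < m)%N /\
  exists (T : set 'M[R]_(m, 3)) (f : 'M[R]_(m, 3) -> W),
    [/\ affine_slice (@lorentz_cone_pow m) T, affine_map f & S = f @` T].

End SecondOrderCones.

(* Main.v *)
Require Import Defs.
From HB Require Import structures.
From mathcomp Require Import all_boot all_order all_algebra.
From mathcomp Require Import all_classical all_reals.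
From mathcomp Require Import zify ring lra polyrcf.

(** A spectrahedron S of dimension at most 3 is sent by M : x |-> A x + B into a
    linear space of symmetric matrices of dimension at most 4. Symmetric 3 x 3 matrices
    form a space of dimension 6, so at least a pencil of symmetric matrices P
    satisfies tr (P M(x)) = 0 for all x in S, and since the determinant is a cubic,
    this pencil contains a singular P <> 0 ([symmetric_annihilator]).

    Such a P has rank at most 2, hence is a binary quadratic form. If it is
    indefinite it is a product of two independent linear forms u and v, and the
    trace condition reads u^T M(x) v = 0. If it is semidefinite, then the trace
    condition and the semidefiniteness of M(x) put a fixed nonzero vector u in the
    kernel of every M(x), and u^T M(x) v = 0 for any v. In both cases there is a
    basis g such that N(x) = g^T M(x) g has a zero entry N01 for all x in S
    ([singular_trace_congr]).

    With N01 = 0 the matrix N(x) is semidefinite iff N22 can be written c + c' with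
    N02^2 <= N00 c and N12^2 <= N11 c', the diagonal entries and c, c' being
    nonnegative ([psdmx_arrowP]). Each of these two conditions is membership in a
    rotated Lorentz cone, and the equation N01 = 0 is membership of (N01, 0, 0), so S
    is the projection of the pairs (x, c) that an affine map sends into the third
    power of the cone ([spectrahedron_arrow_socr], [affinely_socr_lift]). *)

Import Order.TTheory GRing.Theory Num.Theory.

Set Implicit Arguments.
Unset Strict Implicit.
Unset Printing Implicit Defensive.

Local Open Scope ring_scope.

(** * Symmetric matrices of size three *)

Lemma symmetricmxP (R : fieldType) (k : nat) (M : 'M[R]_k) :
  M \is symmetricmx <-> M^T = M.
Proof.
split=> [/is_hermitianmxP e|e]; last apply/is_hermitianmxP.
  by rewrite {2}e expr0 scale1r map_mx_id.
by rewrite expr0 scale1r map_mx_id.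
Qed.

Lemma I3P (i : 'I_3) : [\/ i = 0, i = 1 | i = 2].
Proof.
by case: i => [[|[|[|//]]] ?]; [apply: Or31 | apply: Or32 | apply: Or33];
  apply/val_inj.
Qed.

Lemma big_ord3 (V : nmodType) (F : 'I_3 -> V) : \sum_i F i = F 0 + F 1 + F 2.
Proof.
rewrite !big_ord_recl big_ord0 addr0 addrA.
by congr (F _ + F _ + F _); apply/val_inj.
Qed.

Lemma quad_form3 (R : comPzRingType) (N : 'M[R]_3) (v : 'cV[R]_3) : N^T = N ->
  (v^T *m N *m v) 0 0 = N 0 0 * v 0 0 ^+ 2 + N 1 1 * v 1 0 ^+ 2 + N 2 2 * v 2 0 ^+ 2
    + 2 * N 0 1 * v 0 0 * v 1 0 + 2 * N 0 2 * v 0 0 * v 2 0 + 2 * N 1 2 * v 1 0 * v 2 0.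
Proof.
move=> NT; have Nsym i j : N i j = N j i by rewrite -[in LHS]NT mxE.
rewrite mxE big_ord3 !mxE !big_ord3 !mxE (Nsym 1 0) (Nsym 2 0) (Nsym 2 1).
by ring.
Qed.

Lemma mxtrace_sym3 (R : comPzRingType) (N Q : 'M[R]_3) : N^T = N -> Q^T = Q ->
  \tr (N *m Q) = N 0 0 * Q 0 0 + N 1 1 * Q 1 1 + N 2 2 * Q 2 2
    + 2 * N 0 1 * Q 0 1 + 2 * N 0 2 * Q 0 2 + 2 * N 1 2 * Q 1 2.
Proof.
move=> NT QT; have Nsym i j : N i j = N j i by rewrite -[in LHS]NT mxE.
have Qsym i j : Q i j = Q j i by rewrite -[in LHS]QT mxE.
rewrite /mxtrace big_ord3 !mxE !big_ord3 (Nsym 1 0) (Nsym 2 0) (Nsym 2 1).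
by rewrite (Qsym 1 0) (Qsym 2 0) (Qsym 2 1); ring.
Qed.

(** * Positive semidefinite matrices *)

Lemma binary_psdP (R : realFieldType) (x y z : R) :
  (forall s t : R, 0 <= x * s ^+ 2 + 2 * y * s * t + z * t ^+ 2) <->
  [/\ 0 <= x, 0 <= z & y ^+ 2 <= x * z].
Proof.
split=> [h|[x0 z0 h] s t].
  have x0 : 0 <= x by have := h 1 0; lra.
  have z0 : 0 <= z by have := h 0 1; lra.
  split=> //; have [xE|xn0] := eqVneq x 0.
    have [-> | yn0] := eqVneq y 0; first by rewrite xE; lra.
    (* The linear term 2 y s is unbounded below: this s gives the value - z - 2. *)
    have := h (- (z + 1) / y) 1.
    have -> : x * (- (z + 1) / y) ^+ 2 + 2 * y * (- (z + 1) / y) * 1 + z * 1 ^+ 2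
      = - z - 2 by rewrite xE; field.
    by lra.
  have := h (- y) x.
  have -> : x * (- y) ^+ 2 + 2 * y * - y * x + z * x ^+ 2 = x * (x * z - y ^+ 2) by ring.
  by rewrite pmulr_rge0 ?subr_ge0 // lt_def xn0.
have [xE|xn0] := eqVneq x 0.
  have -> : y = 0.
    apply/eqP; rewrite -sqrf_eq0 eq_le sqr_ge0 andbT.
    by move: h; rewrite xE mul0r.
  by have := sqr_ge0 t; rewrite xE; nra.
have xp : 0 < x by rewrite lt_def xn0.
rewrite -(pmulr_rge0 _ xp).
have -> : x * (x * s ^+ 2 + 2 * y * s * t + z * t ^+ 2) =
  (x * s + y * t) ^+ 2 + (x * z - y ^+ 2) * t ^+ 2 by ring.
by rewrite addr_ge0 ?sqr_ge0 // mulr_ge0 ?sqr_ge0 ?subr_ge0.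
Qed.

Lemma psdmx_congr (R : realType) (k : nat) (g M : 'M[R]_k) :
  psdmx M -> psdmx (g^T *m M *m g).
Proof.
move=> [/symmetricmxP Ms Mp]; split=> [|v].
  by apply/symmetricmxP; rewrite !trmx_mul trmxK Ms mulmxA.
have := Mp (g *m v); congr (0 <= (fun_of_matrix _ _ _)).
by rewrite trmx_mul !mulmxA.
Qed.

Lemma psdmx_congr_unit (R : realType) (k : nat) (g M : 'M[R]_k) :
  g \in unitmx -> psdmx (g^T *m M *m g) <-> psdmx M.
Proof.
move=> gu; split=> [/(psdmx_congr (invmx g))|]; last exact: psdmx_congr.
congr psdmx; rewrite -!mulmxA mulmxV // mulmx1 !mulmxA -trmx_mul mulmxV //.
by rewrite trmx1 mul1mx.
Qed.

Lemma psdmx_diag2 (R : realType) (N : 'M[R]_3) : psdmx N ->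
  [/\ 0 <= N 0 0, 0 <= N 1 1 & N 0 1 ^+ 2 <= N 0 0 * N 1 1].
Proof.
move=> [/symmetricmxP Ns Np]; apply/binary_psdP => s t.
have := Np (\col_i [:: s; t; 0]`_i); rewrite quad_form3 // !mxE /=.
by congr (0 <= _); ring.
Qed.

(** A matrix whose (0, 1) entry vanishes couples the coordinates 0 and 1 only
    through the coordinate 2, so its quadratic form is positive semidefinite iff
    it splits as a form in the coordinates 0, 2 plus a form in the coordinates
    1, 2, both semidefinite: the entry N22 is shared between them. *)
Lemma psdmx_arrowP (R : realType) (N : 'M[R]_3) : N^T = N -> N 0 1 = 0 ->
  psdmx N <-> exists c : R,
    [/\ 0 <= N 0 0, 0 <= c & N 0 2 ^+ 2 <= N 0 0 * c] /\
    [/\ 0 <= N 1 1, 0 <= N 2 2 - c & N 1 2 ^+ 2 <= N 1 1 * (N 2 2 - c)].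
Proof.
move=> Ns N01; split=> [[_ Np]|[c [/binary_psdP h0 /binary_psdP h1]]]; last first.
  split=> [|v]; first exact/symmetricmxP.
  rewrite quad_form3 //; move: (h0 (v 0 0) (v 2 0)) (h1 (v 1 0) (v 2 0)).
  by rewrite N01; lra.
have Nq a b c : 0 <= N 0 0 * a ^+ 2 + N 1 1 * b ^+ 2 + N 2 2 * c ^+ 2
    + 2 * N 0 2 * a * c + 2 * N 1 2 * b * c.
  have := Np (\col_i [:: a; b; c]`_i); rewrite quad_form3 // !mxE /= N01.
  by congr (0 <= _); ring.
have [a0 c0 h02] : [/\ 0 <= N 0 0, 0 <= N 2 2 & N 0 2 ^+ 2 <= N 0 0 * N 2 2].
  by apply/binary_psdP => s t; have := Nq s 0 t; congr (0 <= _); ring.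
(* The least admissible c is the Schur complement term N02^2 / N00; with the
   convention x / 0 = 0 it is also right when N00 = 0, which forces N02 = 0. *)
exists (N 0 2 ^+ 2 / N 0 0).
have aE : N 0 0 * (N 0 2 ^+ 2 / N 0 0) = N 0 2 ^+ 2.
  have [z|nz] := eqVneq (N 0 0) 0; last by rewrite mulrC divfK.
  rewrite z mul0r; apply/eqP; rewrite eq_le sqr_ge0 /=.
  by move: h02; rewrite z mul0r.
split; first by rewrite divr_ge0 ?sqr_ge0 // aE.
(* Minimizing the form over its first variable leaves the second block. *)
apply/binary_psdP => s t; have := Nq (- N 0 2 / N 0 0 * t) s t.
congr (0 <= _).
have [z|nz] := eqVneq (N 0 0) 0; last by field.
by rewrite z invr0; ring.
Qed.

(** * Second-order cone representations *)

Lemma lorentzP (R : realType) (x : 'rV[R]_3) :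
  lorentz_cone x <-> 0 <= x 0 2 /\ x 0 0 ^+ 2 + x 0 1 ^+ 2 <= x 0 2 ^+ 2.
Proof.
rewrite /lorentz_cone /=; split=> [h|[h0 h]].
  have h0 : 0 <= x 0 2 by apply: le_trans h; exact: sqrtr_ge0.
  split=> //; rewrite -ler_sqrt ?sqr_ge0 // sqrtr_sqr ger0_norm //.
by rewrite -[leRHS]ger0_norm // -sqrtr_sqr ler_wsqrtr.
Qed.

(** The determinant inequality x z >= y^2 is the rotated form of the cone:
    (x + z)^2 - (x - z)^2 = 4 x z. *)
Lemma lorentz_binary (R : realType) (x y z : R) (w : 'rV[R]_3) :
  w = \row_j [:: x - z; 2 * y; x + z]`_j ->
  lorentz_cone w <-> [/\ 0 <= x, 0 <= z & y ^+ 2 <= x * z].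
Proof.
move=> ->; rewrite lorentzP !mxE /=; split=> [[h0 h]|[x0 z0 h]]; last first.
  by split; [exact: addr_ge0 | nra].
have h1 : y ^+ 2 <= x * z by nra.
have xz := le_trans (sqr_ge0 y) h1.
by split=> //; nra.
Qed.

(** A slice consists of points of the cone, and G need not be injective, so the
    value G e does not determine pi e. Therefore q further factors are added that
    record e: the first coordinate of a point of the cone is an arbitrary real. *)
Lemma affinely_socr_lift (R : realType) (W : vectType R) (q m : nat)
    (G : 'rV[R]_q -> 'M[R]_(m, 3)) (pi : 'rV[R]_q -> W) (S : set W) :
  (0 < m)%N -> affine_map G -> affine_map pi ->
  (forall w, S w <-> exists2 e, lorentz_cone_pow (G e) & w = pi e) ->
  affinely_socr S.
Proof.
move=> m0 [GL [G0 GE]] [piL [pi0 piE]] SE.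
pose coords (X : 'M[R]_(m + q, 3)) : 'rV[R]_q := (col 0 (dsubmx X))^T.
have coordsD : {morph coords : X Y / X + Y} by move=> X Y; apply/rowP=> j; rewrite !mxE.
have coordsZ a : {morph coords : X / a *: X} by move=> X; apply/rowP=> j; rewrite !mxE.
pose D (X : 'M[R]_(m + q, 3)) := usubmx X - GL (coords X).
have D_lin : linear D.
  move=> a X Y; rewrite /D coordsD coordsZ linearP [GL _]linearP scalerBr.
  by rewrite addrACA -opprD.
pose DL : {linear 'M[R]_(m + q, 3) -> 'M[R]_(m, 3)} :=
  HB.pack D (GRing.isLinear.Build _ _ _ _ D D_lin).
have P_lin : linear (piL \o coords).
  by move=> a X Y; rewrite /= coordsD coordsZ linearP.
pose PL : {linear 'M[R]_(m + q, 3) -> W} :=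
  HB.pack (piL \o coords) (GRing.isLinear.Build _ _ _ _ (piL \o coords) P_lin).
pose L : set 'M[R]_(m + q, 3) := [set X | usubmx X = G (coords X)]%classic.
exists (m + q)%N; split; first by rewrite addn_gt0 m0.
exists (@lorentz_cone_pow R (m + q) `&` L)%classic, (pi \o coords); split.
- (* G0 is the constant term of G, so (G0, 0) satisfies the affine equations
     usubmx X = G (coords X). *)
  exists L => //; exists (col_mx G0 0), (lker (linfun DL)).
  apply/seteqP; split=> X; rewrite /flat /= memv_ker (lfunE DL) /= /D linearB /= col_mxKu.
    have -> : coords (X - col_mx G0 0) = coords X.
      by apply/rowP=> j; rewrite !mxE (unsplitK (inr j)) mxE subr0.
    by rewrite /L /= GE => ->; rewrite addrK subrr.
  have -> : coords (X - col_mx G0 0) = coords X.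
    by apply/rowP=> j; rewrite !mxE (unsplitK (inr j)) mxE subr0.
  by rewrite /L /= GE subr_eq0 subr_eq => /eqP.
- by exists PL, pi0 => X; rewrite /= piE.
apply/seteqP; split=> w /=.
  move=> /SE[e Ge ->].
  (* (t, 0, |t|) lies in the cone for every t. *)
  exists (col_mx (G e) (\matrix_(j, k) [:: e 0 j; 0; `|e 0 j|]`_k)).
    have cE : coords (col_mx (G e) (\matrix_(j, k) [:: e 0 j; 0; `|e 0 j|]`_k)) = e.
      by apply/rowP=> j; rewrite /coords col_mxKd !mxE.
    split; last by rewrite /L /= col_mxKu cE.
    move=> i; rewrite -[i]splitK; case: fintype.split => j /=.
      by rewrite rowKu; exact: Ge.
    rewrite rowKd; apply/lorentzP; rewrite !mxE /=.
    by rewrite expr0n addr0 real_normK ?num_real // normr_ge0.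
  by congr pi; apply/rowP=> j; rewrite /coords col_mxKd !mxE.
move=> [X [Xcone XL] <-]; apply/SE; exists (coords X) => // i.
have := Xcone (lshift q i); rewrite -XL; congr lorentz_cone.
by apply/rowP=> j; rewrite !mxE.
Qed.

(** The vanishing of one off-diagonal entry on the spectrahedron may be added to
    the LMI as an affine equation; with it, the LMI splits into two binary ones. *)
Lemma spectrahedron_arrow_socr (R : realType) (n : nat)
    (A : {linear 'rV[R]_n -> 'M[R]_3}) (B g : 'M[R]_3) :
  (forall x, A x \is symmetricmx) -> B \is symmetricmx -> g \in unitmx ->
  (forall x, spectrahedron A B x -> (g^T *m (A x + B) *m g) 0 1 = 0) ->
  affinely_socr (spectrahedron A B).
Proof.
move=> A_sym B_sym gu g01.
(* Row 0 lies in the cone iff N01 = 0; rows 1 and 2 lie in it iff the two binary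
   blocks, which share the entry N22 as c + (N22 - c), are semidefinite. *)
pose arrow (N : 'M[R]_3) (c : R) : 'M[R]_3 := \matrix_(i, j)
  nth 0 (nth [::] [:: [:: N 0 1; 0; 0];
       [:: N 0 0 - c; 2 * N 0 2; N 0 0 + c];
       [:: N 1 1 - (N 2 2 - c); 2 * N 1 2; N 1 1 + (N 2 2 - c)]] i) j.
have arrow_lin a N c N' c' :
    arrow (a *: N + N') (a * c + c') = a *: arrow N c + arrow N' c'.
  apply/matrixP=> i j; rewrite !mxE.
  by case: i => [[|[|[|//]]] ?]; case: j => [[|[|[|//]]] ?]; rewrite /= ?mxE; ring.
pose N x := g^T *m (A x + B) *m g.
have Nsym x : (N x)^T = N x.
  have MT : (A x + B)^T = A x + B.
    by rewrite linearD /= !(symmetricmxP _).1.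
  by rewrite /N !trmx_mul trmxK MT mulmxA.
pose GL (e : 'rV[R]_(n + 1)) := arrow (g^T *m A (lsubmx e) *m g) (e 0 (rshift n 0)).
have GL_lin : linear GL.
  move=> a e e'; rewrite /GL -arrow_lin linearP [A _]linearP mulmxDr mulmxDl.
  by rewrite -scalemxAr -scalemxAl !mxE.
pose GLL : {linear 'rV[R]_(n + 1) -> 'M[R]_3} :=
  HB.pack GL (GRing.isLinear.Build _ _ _ _ GL GL_lin).
apply: (@affinely_socr_lift R _ (n + 1) 3
  (fun e => arrow (N (lsubmx e)) (e 0 (rshift n 0))) lsubmx) => //.
- exists GLL, (arrow (g^T *m B *m g) 0) => e.
  rewrite /= -[GL e]scale1r -arrow_lin scale1r mul1r addr0 /N.
  by rewrite mulmxDr mulmxDl.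
- by exists lsubmx, 0 => e; rewrite addr0.
have coneE x c : lorentz_cone_pow (arrow (N x) c) <->
    [/\ N x 0 1 = 0, [/\ 0 <= N x 0 0, 0 <= c & N x 0 2 ^+ 2 <= N x 0 0 * c] &
     [/\ 0 <= N x 1 1, 0 <= N x 2 2 - c & N x 1 2 ^+ 2 <= N x 1 1 * (N x 2 2 - c)]].
  have row1 : row 1 (arrow (N x) c) =
      \row_j [:: N x 0 0 - c; 2 * N x 0 2; N x 0 0 + c]`_j.
    by apply/rowP => j; rewrite !mxE.
  have row2 : row 2 (arrow (N x) c) =
      \row_j [:: N x 1 1 - (N x 2 2 - c); 2 * N x 1 2; N x 1 1 + (N x 2 2 - c)]`_j.
    by apply/rowP => j; rewrite !mxE.
  have row0 : lorentz_cone (row 0 (arrow (N x) c)) <-> N x 0 1 = 0.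
    rewrite lorentzP !mxE /=; split=> [[_ h]|->]; last by rewrite expr0n addr0 lexx.
    by apply/eqP; rewrite -sqrf_eq0 eq_le sqr_ge0 andbT; move: h; rewrite expr0n addr0.
  split=> [h|[/row0 h0 /(lorentz_binary row1) h1 /(lorentz_binary row2) h2] i].
    split; first by apply/row0; exact: h.
      by apply/(lorentz_binary row1); exact: h.
    by apply/(lorentz_binary row2); exact: h.
  by case: (I3P i) => ->.
move=> x; split=> [Sx|[e + ->]].
  have /(psdmx_arrowP (Nsym x) (g01 x Sx))[c [h1 h2]] : psdmx (N x).
    exact: psdmx_congr.
  exists (row_mx x (const_mx c)); rewrite row_mxKl // row_mxEr mxE.
  by apply/coneE; split=> //; exact: g01.
move=> /coneE[N01 h1 h2]; apply/(psdmx_congr_unit (A (lsubmx e) + B) gu).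
by apply/(psdmx_arrowP (Nsym _) N01); exists (e 0 (rshift n 0)).
Qed.

(** * Singular matrices orthogonal to the spectrahedron *)

Lemma unitmx_with_row (K : fieldType) (k : nat) (i : 'I_k) (v : 'rV[K]_k) : v != 0 ->
  exists2 h : 'M[K]_k, h \in unitmx & row i h = v.
Proof.
move=> vn0; pose U : 'rV[K]_k := delta_mx 0 i.
(* The unit vector U is sent to v by the matrix all of whose rows are v; only
   its action on U matters. *)
have Uf : U *m (\matrix_(j < k) v) = v by rewrite -rowE rowK.
have rk : \rank (U *m (\matrix_(j < k) v)) = \rank U.
  by rewrite Uf !rank_rV vn0; apply/esym/eqP; rewrite eqb1; apply/eqP => /rowP /(_ i);
     rewrite !mxE !eqxx => /eqP; rewrite oner_eq0.
have [h hu hE] := complete_unitmx rk.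
by exists h => //; rewrite rowE -hE.
Qed.

(** If F p1 is nonsingular, then det (F (p2 - l p1)) is a polynomial in l of odd
    degree k with real coefficients, so it has a zero. *)
Lemma pencil_singular (R : rcfType) (k : nat) (V : vectType R)
    (F : {linear V -> 'M[R]_k}) (U : {vspace V}) :
  odd k -> (2 <= \dim U)%N ->
  exists2 p : V, p \in U & (p != 0) && (\det (F p) == 0).
Proof.
move=> k_odd dimU.
pose p1 := vpick U.
have p1U : p1 \in U by exact: memv_pick.
have p1n0 : p1 != 0 by rewrite vpick0 -dimv_eq0 -lt0n ltnW.
have [d0 | dn0] := eqVneq (\det (F p1)) 0.
  by exists p1 => //; rewrite p1n0 d0 eqxx.
have /subvPn[p2 p2U p2p1] : ~~ (U <= <[p1]>)%VS.
  apply/negP => /dimvS; rewrite dim_vline p1n0 => h.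
  by move: (leq_trans dimU h).
have F1u : F p1 \in unitmx by rewrite unitmxE unitfE.
(* If F p1 is invertible, F p2 - l F p1 is singular exactly when l is an
   eigenvalue of F p2 (F p1)^-1, and the characteristic polynomial has odd
   degree k. *)
have [l] : {l | root (char_poly (F p2 *m invmx (F p1))) l}.
  by apply: odd_poly_root; rewrite size_char_poly /= k_odd.
rewrite -eigenvalue_root_char => /eigenvalueP[v vE vn0].
exists (p2 - l *: p1); first by rewrite rpredB ?rpredZ.
apply/andP; split.
  apply: contra p2p1; rewrite subr_eq0 => /eqP ->.
  by rewrite rpredZ ?memv_line.
apply/det0P; exists v => //.
rewrite linearB linearZ mulmxBr /= -scalemxAr scalemxAl -vE.
by rewrite mulmxA -!mulmxA mulVmx // mulmx1 subrr.
Qed.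

(** Read (x, y, z) as a positive semidefinite binary form orthogonal to the
    symmetric matrix with entries a, b, c. The claim provides two independent
    vectors (s, t) and (s', t'), the same for all these forms, that are conjugate
    for each of them. If the matrix is indefinite it is a symmetrized product of two
    independent vectors; if it is semidefinite, the orthogonality forces a fixed
    vector into the kernel of the form, and any second vector will do. *)
Lemma binary_trace_zero (R : rcfType) (a b c : R) :
  [|| a != 0, b != 0 | c != 0] ->
  exists s t s' t' : R, s * t' - s' * t != 0 /\
  forall x y z : R, 0 <= x -> 0 <= z -> y ^+ 2 <= x * z ->
    a * x + 2 * b * y + c * z = 0 ->
    s * s' * x + (s * t' + t * s') * y + t * t' * z = 0.
Proof.
have [-> | a0 _] := eqVneq a 0; last first.
  have [le0 | gt0] := lerP (b ^+ 2 - a * c) 0.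
    (* The value a^2 x + 2 a b y + b^2 z of the form at (a, b) equals
       a (a x + 2 b y + c z) + (b^2 - a c) z <= 0; by Cauchy-Schwarz (a, b) then lies
       in the kernel of the form. *)
    exists a, b, 0, 1; rewrite mulr1 mul0r subr0; split=> // x y z x0 z0 h e.
    rewrite mulr0 mul0r mulr0 addr0 !mulr1 add0r.
    have e1 : (a ^+ 2 * x + 2 * a * b * y + b ^+ 2 * z) = (b ^+ 2 - a * c) * z.
      by transitivity (a * (a * x + 2 * b * y + c * z) + (b ^+ 2 - a * c) * z);
        [ring | rewrite e; ring].
    apply/eqP; rewrite -sqrf_eq0 eq_le sqr_ge0 andbT.
    have -> : (a * y + b * z) ^+ 2 = a ^+ 2 * (y ^+ 2 - x * z) +
       (a ^+ 2 * x + 2 * a * b * y + b ^+ 2 * z) * z by ring.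
    rewrite e1 -[leRHS]addr0 lerD //.
      by apply: mulr_ge0_le0; rewrite ?sqr_ge0 ?subr_le0.
    by rewrite -mulrA mulr_le0_ge0 // mulr_ge0.
  (* a (a s^2 + 2 b s t + c t^2) factors over R as
     (a s + (b + r) t) (a s + (b - r) t), with r^2 = b^2 - a c. *)
  exists a, (b + Num.sqrt (b ^+ 2 - a * c)), a, (b - Num.sqrt (b ^+ 2 - a * c)).
  have r0 : 0 < Num.sqrt (b ^+ 2 - a * c) by rewrite sqrtr_gt0.
  have rE := sqr_sqrtr (ltW gt0).
  set r := Num.sqrt _ in r0 rE *.
  split=> [|x y z x0 z0 h e].
    have -> : a * (b - r) - a * (b + r) = - (2 * (a * r)) by ring.
    by rewrite oppr_eq0 !mulf_eq0 pnatr_eq0 (negPf a0) (gt_eqF r0).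
  transitivity (a * (a * x + 2 * b * y + c * z) + (b ^+ 2 - a * c - r ^+ 2) * z);
    first by ring.
  by rewrite e rE subrr mulr0 mul0r addr0.
have [-> | b0 _] /= := eqVneq b 0; last first.
  exists (2 * b), c, 0, 1; split=> [|x y z x0 z0 h e].
    by rewrite mulr1 mul0r subr0 mulf_eq0 pnatr_eq0.
  by rewrite -[RHS]e; ring.
move=> c0; exists 1, 0, 0, 1; split=> [|x y z x0 z0 h].
  by rewrite mulr1 mul0r subr0 oner_neq0.
rewrite mul0r add0r mulr0 mul0r add0r => /eqP; rewrite mulf_eq0 (negPf c0) /= => /eqP z0'.
have -> : y = 0.
  apply/eqP; rewrite -sqrf_eq0 eq_le sqr_ge0 andbT.
  by move: h; rewrite z0' mulr0.
by rewrite z0'; ring.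
Qed.

(** A singular symmetric matrix is a binary form, to which [binary_trace_zero]
    applies: the two conjugate vectors become the first two columns of g. *)
Lemma singular_trace_congr (R : realType) (P : 'M[R]_3) :
  P^T = P -> P != 0 -> \det P = 0 ->
  exists2 g : 'M[R]_3, g \in unitmx &
    forall M, psdmx M -> \tr (P *m M) = 0 -> (g^T *m M *m g) 0 1 = 0.
Proof.
move=> PT Pn0 /eqP/det0P[v vn0 vP].
have [h hu hv] := unitmx_with_row 2 vn0.
pose N := h *m P *m h^T.
have NT : N^T = N by rewrite /N !trmx_mul trmxK PT mulmxA.
have Nsym i j : N i j = N j i by rewrite -[in LHS]NT mxE.
have N2 j : N 2 j = 0.
  have : row 2 N = 0 by rewrite /N !row_mul hv vP mul0mx.
  by move=> /rowP /(_ j); rewrite !mxE.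
(* In a basis whose third vector spans part of the kernel, P is the binary form
   (N00, N01, N11); by duality the matrices M change by k = h^-1. *)
have PE : P = invmx h *m N *m (invmx h)^T.
  rewrite /N !mulmxA mulVmx // mul1mx -mulmxA -trmx_mul mulVmx //.
  by rewrite trmx1 mulmx1.
have Nn0 : [|| N 0 0 != 0, N 0 1 != 0 | N 1 1 != 0].
  apply: contraR Pn0; rewrite !negb_or !negbK => /and3P[/eqP n00 /eqP n01 /eqP n11].
  suff N0 : N = 0 by rewrite PE N0 mulmx0 mul0mx.
  apply/matrixP => i j; rewrite [RHS]mxE.
  by case: (I3P i) => ->; case: (I3P j) => ->; rewrite ?N2 // Nsym ?N2.
clearbody N.
have [s [t [s' [t' [det_n0 stP]]]]] := binary_trace_zero Nn0.
(* The columns of e are the two vectors found, completed by the third basis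
   vector. *)
pose e : 'M[R]_3 := \matrix_(i, j)
  nth 0 (nth [::] [:: [:: s; s'; 0]; [:: t; t'; 0]; [:: 0; 0; 1]] i) j.
have eu : e \in unitmx.
  rewrite unitmxE unitfE.
  suff -> : \det e = s * t' - s' * t by [].
  rewrite (expand_det_row _ 2) big_ord3 !mxE /= !mul0r !add0r mul1r.
  rewrite /cofactor (expand_det_row _ 0) !big_ord_recl big_ord0 /cofactor.
  rewrite !det_mx11 !mxE /=.
  by rewrite /bump /=; ring.
pose k := invmx h.
exists (k *m e); first by rewrite unitmx_mul eu unitmx_inv hu.
move=> M psdM trPM.
have psdQ := psdmx_congr k psdM; set Q := k^T *m M *m k in psdQ.
have -> : (k *m e)^T *m M *m (k *m e) = e^T *m Q *m e.
  by rewrite /Q trmx_mul !mulmxA.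
have [x0 z0 yy] := psdmx_diag2 psdQ.
have QT : Q^T = Q by have [/symmetricmxP] := psdQ.
have Qsym i j : Q i j = Q j i by rewrite -[in LHS]QT mxE.
have trE : N 0 0 * Q 0 0 + 2 * N 0 1 * Q 0 1 + N 1 1 * Q 1 1 = 0.
  rewrite -trPM PE -!mulmxA mxtrace_mulC -!mulmxA -/k.
  have -> : k^T *m (M *m k) = Q by rewrite /Q mulmxA.
  rewrite mxtrace_sym3 // (Nsym 0 2) (Nsym 1 2) !N2.
  by ring.
clearbody Q.
rewrite -[RHS](stP _ _ _ x0 z0 yy trE).
rewrite mxE big_ord3 !mxE !big_ord3 !mxE /= (Qsym 1 0).
by ring.
Qed.

(** The matrices A x + B, for x in a flat of dimension at most 3, span a space of
    dimension at most 4; its annihilator in the 6-dimensional space of symmetric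
    matrices has dimension at least 2, so it contains a singular element. *)
Lemma symmetric_annihilator (R : realType) (n : nat)
    (A : {linear 'rV[R]_n -> 'M[R]_3}) (B : 'M[R]_3) (p : 'rV[R]_n)
    (U : {vspace 'rV[R]_n}) :
  (\dim U <= 3)%N ->
  exists P : 'M[R]_3, [/\ P^T = P, P != 0, \det P = 0 &
    forall x, flat p U x -> \tr (P *m (A x + B)) = 0].
Proof.
move=> dimU.
(* The six entries on and above the diagonal: (0,0), (0,1), (0,2), (1,1), (1,2),
   (2,2) are numbered 0 to 5. *)
pose idx (i j : 'I_3) : 'I_6 := inord (i + j + ((0 < i) && (0 < j)))%N.
have idxC i j : idx i j = idx j i by rewrite /idx andbC [(i + j)%N]addnC.
pose sym (q : 'rV[R]_6) : 'M[R]_3 := \matrix_(i, j) q 0 (idx i j).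
have sym_lin : linear sym by move=> a q q'; apply/matrixP => i j; rewrite !mxE.
pose symL : {linear 'rV[R]_6 -> 'M[R]_3} :=
  HB.pack sym (GRing.isLinear.Build _ _ _ _ sym sym_lin).
have sym0 q : sym q = 0 -> q = 0.
  move=> /matrixP q0; apply/rowP => l; rewrite [RHS]mxE.
  have [i [j <-]] : exists i j, idx i j = l.
    case: l => [[|[|[|[|[|[|//]]]]]] ?];
      [exists 0, 0 | exists 0, 1 | exists 0, 2 | exists 1, 1 | exists 1, 2 | exists 2, 2];
      by apply/val_inj; rewrite /= inordK.
  by have := q0 i j; rewrite !mxE.
(* On p + U, the trace against A x + B is controlled by its value at p and by
   its linear part on a basis of U: at most four equations in six unknowns. *)
pose test (q : 'rV[R]_6) : 'rV[R]_(1 + \dim U) :=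
  row_mx (const_mx (\tr (sym q *m (A p + B))))
    (\row_i \tr (sym q *m A (vbasis U)`_i)).
have test_lin : linear test.
  move=> a q q'; rewrite /test [sym _]sym_lin scale_row_mx add_row_mx.
  congr row_mx; apply/rowP => i; rewrite !mxE mulmxDl mxtraceD;
  by rewrite -scalemxAl mxtraceZ.
pose testL : {linear 'rV[R]_6 -> 'rV[R]_(1 + \dim U)} :=
  HB.pack test (GRing.isLinear.Build _ _ _ _ test test_lin).
pose K := lker (linfun testL).
have dimK : (2 <= \dim K)%N.
  have := limg_ker_dim (linfun testL) fullv; rewrite capfv -/K dimvf /dim /= mul1n.
  have := dimvS (subvf (limg (linfun testL))); rewrite dimvf /dim /= mul1n.
  lia.
have [//|q qK /andP[qn0 /eqP dq]] := pencil_singular symL _ dimK.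
exists (sym q); split=> //.
- by apply/matrixP => i j; rewrite !mxE idxC.
- by apply: contra qn0 => /eqP /sym0 ->.
have test0 : test q = 0 by apply/eqP; move: qK; rewrite memv_ker (lfunE testL).
have [tp tU] : \tr (sym q *m (A p + B)) = 0 /\
    forall i : 'I_(\dim U), \tr (sym q *m A (vbasis U)`_i) = 0.
  move: test0; rewrite /test -[RHS]row_mx0 => /eq_row_mx[/rowP e1 /rowP e2].
  by split=> [|i]; [have := e1 0 | have := e2 i]; rewrite !mxE.
move=> x /coord_vbasis xE.
have -> : A x + B = A (x - p) + (A p + B) by rewrite addrA -[in RHS]linearD subrK.
rewrite mulmxDr mxtraceD tp addr0 xE (linear_sum A) mulmx_sumr raddf_sum big1 // => i _.
by rewrite linearZ /= -scalemxAr mxtraceZ tU mulr0.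
Qed.

(** * Spectrahedra of dimension at most three *)

Lemma sub_affine_hull (R : realType) (V : vectType R) (S : set V) x :
  S x -> affine_hull S x.
Proof.
move=> Sx; exists 1%N, (fun=> x), (fun=> 1).
by split=> //; rewrite big_ord1 // scale1r.
Qed.

Unset Implicit Arguments.

Theorem corollary3 (R : realType) (n : nat) (n_gt0 : (0 < n)%N)
    (A : {linear 'rV[R]_n -> 'M[R]_3}) (B : 'M[R]_3)
    (A_sym : forall x : 'rV[R]_n, A x \is symmetricmx)
    (B_sym : B \is symmetricmx)
    (dim_le3 : exists d : int, affine_dim (spectrahedron A B) d /\ d <= 3) :
  affinely_socr (spectrahedron A B).
Proof.
(* An empty spectrahedron satisfies the vanishing condition vacuously. *)
have [d [[[S0 _]|[p [U [hullE dE]]]] d3]] := dim_le3.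
  apply: (@spectrahedron_arrow_socr _ _ _ _ 1%:M) => //; first exact: unitmx1.
  by move=> x; rewrite S0.
have dimU : (\dim U <= 3)%N by move: d3; rewrite dE.
have [P [PT Pn0 detP trP]] := symmetric_annihilator A B p dimU.
have [g gu g01] := singular_trace_congr PT Pn0 detP.
apply: (spectrahedron_arrow_socr A_sym B_sym gu) => x Sx.
by apply: g01 => //; apply: trP; rewrite -hullE; exact: sub_affine_hull.
Qed.
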